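(* Let $\sigma=\sigma_1\sigma_2\cdots\sigma_k$ be a Cayley permutation with $k\ge 2$ and $\sigma\neq 12$, and let $\hat{\sigma}=\sigma_2\sigma_1\sigma_3\cdots\sigma_k$. If $\hat{\sigma}$ avoids $231$, then $\mathrm{Sort}(\sigma)$ is not a class.
   Context: A Cayley permutation is a finite word $\pi=\pi_1\cdots\pi_n$ over the positive integers such that every integer from $1$ to $\max(\pi)$ occurs at least once; $\mathcal{C}$ denotes the set of all Cayley permutations. A word $x=x_1\cdots x_n$ contains a pattern $p=p_1\cdots p_k$ if there are indices $i_1<\cdots<i_k$ such that for all $u,v$: $x_{i_u}<x_{i_v}$ iff $p_u<p_v$, and $x_{i_u}=x_{i_v}$ iff $p_u=p_v$; otherwise $x$ avoids $p$. A class is a subset of $\mathcal{C}$ closed downwards under pattern containment (if $\pi$ is in the set and $\pi$ contains $\tau\in\mathcal{C}$, then $\tau$ is in the set). For a Cayley permutation $\tau$ of length at least two, a $\tau$-stack processes an input word from left to right with the following right-greedy algorithm: while the input is nonempty, if pushing the next input element onto the stack yields stack contents which, read from top to bottom, avoid $\tau$, the element is pushed; otherwise the top element of the stack is popped and appended to the output. When the input is exhausted, the remaining elements are popped one by one. Denote by $s_\tau(\pi)$ the output of the $\tau$-stack on input $\pi$. The $\sigma$-machine consists of a $\sigma$-stack followed in series by a $21$-stack: $s_\sigma(\pi)$ is used as input of a $21$-stack operated by the same algorithm with $\tau=21$. A Cayley permutation $\pi$ is $\sigma$-sortable if the final output of the $\sigma$-machine on input $\pi$ is weakly increasing; $\mathrm{Sort}(\sigma)$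 denotes the set of $\sigma$-sortable Cayley permutations. *)

(* Defs.v *)
From mathcomp Require Import all_boot.
Set Implicit Arguments.
Unset Strict Implicit.
Unset Printing Implicit Defensive.

Definition word := seq nat.

Definition cayley (w : word) : bool :=
  (0 \notin w) && all (fun i => i \in w) (iota 1 (\max_(i <- w) i)).

Definition order_iso (s p : word) : bool :=
  (size s == size p) &&
  all (fun u => all (fun v =>
         ((nth 0 s u < nth 0 s v) == (nth 0 p u < nth 0 p v)) &&
         ((nth 0 s u == nth 0 s v) == (nth 0 p u == nth 0 p v)))
       (iota 0 (size p))) (iota 0 (size p)).

(* All subsequences, one for each set of positions; see mem_subseqs. *)
Fixpoint subseqs (x : word) : seq word :=
  if x is a :: x' then map (cons a) (subseqs x') ++ subseqs x' else [:: [::]].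

Definition contains (p x : word) : bool :=
  has (fun s => order_iso s p) (subseqs x).

Definition avoids (p x : word) : bool := ~~ contains p x.

Lemma mem_subseqs (s x : word) : (s \in subseqs x) = subseq s x.
Proof.
elim: x s => [|a x IHx] [|b s] //=.
- by rewrite mem_cat IHx sub0seq orbT.
rewrite mem_cat IHx; case: eqVneq => [->|neq_ba].
  rewrite mem_map; last by move=> ? ? [].
  rewrite IHx; apply/orP/idP => [[//|]|->]; last by left.
  exact: (subseq_trans (subseq_cons _ _)).
by rewrite orbC; case: (subseq _ _) => //=; apply/mapP => -[y _ [/eqP]]; rewrite (negPf neq_ba).
Qed.

Lemma containsP (p x : word) :
  reflect (exists2 s, subseq s x & order_iso s p) (contains p x).
Proof.
by apply: (iffP hasP) => -[s sx sp]; exists s; rewrite ?mem_subseqs // -mem_subseqs.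
Qed.

(* Stacks are listed from top to bottom.  [stack_push tau a st] pops until [a]
   can be pushed; it returns the popped elements, in output order, and the new
   stack.  The test is omitted on the empty stack: a one-letter word avoids
   every tau of length at least two. *)
Fixpoint stack_push (tau : word) (a : nat) (st : word) : word * word :=
  if st is b :: st' then
    if avoids tau (a :: st) then ([::], a :: st)
    else let: (out, st1) := stack_push tau a st' in (b :: out, st1)
  else ([::], [:: a]).

Fixpoint stack_run (tau st x : word) : word :=
  if x is a :: x' then
    let: (out, st1) := stack_push tau a st in out ++ stack_run tau st1 x'
  else st.

Definition stack_sort (tau x : word) : word := stack_run tau [::] x.

Definition machine (sigma x : word) : word :=
  stack_sort [:: 2; 1] (stack_sort sigma x).

Definition Sort (sigma : word) : pred word :=
  fun x => cayley x && sorted leq (machine sigma x).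

Definition is_class (C : pred word) : Prop :=
  (forall x, C x -> cayley x) /\
  (forall x t, C x -> cayley t -> contains t x -> C t).

Definition hat (sigma : word) : word :=
  if sigma is a :: b :: s then b :: a :: s else sigma.

(* Main.v *)
(** Since the 21-stack sorts every word avoiding 231, it is enough to follow the
    [sigma]-stack.  Unless [sigma] is 12, 21 or 231, this stack reverses 132 into
    231, so 132 is not sortable.  Write [sigma] = a b t.  A sortable word
    containing 132 is the reversal of [sigma] with extra letters inserted, where
    pushing a still pops b, and where the 3 of the 132 is popped before its 2 is
    pushed.  With 0 < 1/2 below all letters of [sigma] and M above all of them,
    one can take:
    - if a < b, the reversal of a b 0 t, with output b a 0 t;
    - if a = b, the reversal of a M b 0 t, with output M b a 0 t;
    - if a > b and a is not a strict maximum, the reversal of a M b t, with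
      output M b a t;
    - if a > b and a is a strict maximum, the reversal of 1/2 a b 0 b t, with
      output b 0 b 1/2 a t; here b is a minimum, as b a t avoids 231, so that
      the topmost b does not start an occurrence of [sigma] too early.
    The letters are then shifted to make the word a Cayley permutation. *)
Require Import Defs.
From mathcomp Require Import all_boot zify.

Set Implicit Arguments.
Unset Strict Implicit.
Unset Printing Implicit Defensive.

(** * The 21-stack sorts the words avoiding 231 *)

(* A [b] standing before [x] is not the 2 of a 231 with its 31 in [x]. *)
Definition no_hi_lo (b : nat) (x : word) : bool :=
  pairwise (fun c a => ~~ (a < b < c)) x.

Arguments no_hi_lo : simpl never.

(** Each letter is tested as the 2 of a 231; this recursive form unfolds along the explicit outputs
    of the witnesses. *)
Fixpoint av231 (x : word) : bool :=
  if x is b :: x' then no_hi_lo b x' && av231 x' else true.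

Lemma order_iso231 (a b c : nat) :
  a < b < c -> order_iso [:: b; c; a] [:: 2; 3; 1].
Proof.
move=> /andP[ab bc].
by rewrite /order_iso /=; repeat (apply/andP; split=> //); lia.
Qed.

Lemma not_pairwise_subseq (r : rel nat) (x : seq nat) :
  ~~ pairwise r x -> exists u v, subseq [:: u; v] x /\ ~~ r u v.
Proof.
elim: x => //= u x IH; rewrite negb_and => /orP[/allPn[v vx nr]|/IH[p [q [s nr]]]].
  by exists u, v; split=> //; rewrite eqxx sub1seq.
by exists p, q; split=> //; exact: subseq_trans s (subseq_cons _ _).
Qed.

Lemma avoids_av231 (x : word) : avoids [:: 2; 3; 1] x -> av231 x.
Proof.
apply: contraLR => nav; rewrite negbK; apply/containsP.
elim: x nav => //= b x IH; rewrite negb_and => /orP[|/IH[s sx so]]; last first.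
  by exists s => //; exact: subseq_trans sx (subseq_cons _ _).
case/not_pairwise_subseq=> c [a [s]]; rewrite negbK => /order_iso231 so.
by exists [:: b; c; a] => //=; rewrite eqxx.
Qed.

Lemma avoids21_cons (a : nat) (st : word) :
  sorted leq st -> avoids [:: 2; 1] (a :: st) = all (leq a) st.
Proof.
move=> st_sorted; apply/idP/allP => [av b bst|ge_a].
  rewrite leqNgt; apply: contra av => ba; apply/containsP; exists [:: a; b].
    by rewrite /= eqxx sub1seq.
  by rewrite /order_iso /=; repeat (apply/andP; split=> //); lia.
apply/containsP => -[s s_sub].
have : sorted leq (a :: st).
  by rewrite /= path_min_sorted //; apply/allP.
move/(subseq_sorted leq_trans s_sub).
case: s {s_sub} => [|p [|q [|]]] //=; rewrite /order_iso /= => pq.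
by case/and3P=> /andP[/andP[H _] _] *; lia.
Qed.

(** The stack increases from top to bottom, so the letters smaller than [a] lie on top of the
    others, and exactly these have to leave. *)
Lemma stack_push21 (a : nat) (st : word) : sorted leq st ->
  stack_push [:: 2; 1] a st =
    ([seq b <- st | b < a], a :: [seq b <- st | a <= b]).
Proof.
elim: st => // b st IH st_sorted.
have b_le := order_path_min leq_trans st_sorted.
rewrite /stack_push -/stack_push avoids21_cons // IH ?(path_sorted st_sorted) //=.
rewrite leqNgt; case: ltnP => //= ab.
have ge_a : all (leq a) st.
  by apply: sub_all b_le => c; exact: leq_trans.
rewrite ge_a (all_filterP ge_a); congr pair.
rewrite (@eq_in_filter _ _ pred0) ?filter_pred0 // => c /(allP ge_a).
by rewrite ltnNge => ->.
Qed.

(* The condition on [st] excludes a 231 whose 2 is already on the stack. *)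
Lemma stack_run21_sorted (x st : word) :
    sorted leq st -> av231 x ->
    all (fun b => no_hi_lo b x) st ->
  sorted leq (stack_run [:: 2; 1] st x) /\
  stack_run [:: 2; 1] st x =i st ++ x.
Proof.
elim: x st => [|a x IH] st st_sorted; first by rewrite cats0.
move=> /= /andP[av_a av_x] av_st; rewrite stack_push21 //.
have /IH : sorted leq (a :: [seq b <- st | a <= b]).
  by rewrite /= path_min_sorted ?filter_all // sorted_filter //; exact: leq_trans.
case=> // [|run_sorted run_mem].
  rewrite /= av_a; apply/allP => b; rewrite mem_filter => /andP[_ bst].
  by case/andP: (allP av_st _ bst).
split; last first.
  move=> y; rewrite mem_cat run_mem !(mem_cat, inE, mem_filter).
  by rewrite [a <= y]leqNgt; case: (y < a); case: (y == a); case: (y \in st).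
rewrite (sorted_pairwise leq_trans).
rewrite pairwise_cat -!(sorted_pairwise leq_trans).
rewrite run_sorted (sorted_filter leq_trans) // !andbT.
(* Letters popped by [a] must not exceed any later output: a letter [y < b] of [x] would form a 231
   with [b] and [a]. *)
apply/allrelP => b y; rewrite mem_filter run_mem => /andP[ba bst].
rewrite inE mem_cat mem_filter => /or3P[/eqP->|/andP[ay _]|yx]; [lia|lia|].
have /andP[/allP/(_ _ yx)] := allP av_st _ bst.
by rewrite ba andbT -leqNgt.
Qed.

Lemma av231_sort21 (x : word) : av231 x -> sorted leq (stack_sort [:: 2; 1] x).
Proof. by move=> av; case: (@stack_run21_sorted x [::]). Qed.

(** * Pattern containment and the moves of a general stack *)

Lemma contains_sub (tau x y : word) :
  subseq x y -> contains tau x -> contains tau y.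
Proof.
move=> xy /containsP[s sx so]; apply/containsP; exists s => //.
exact: subseq_trans sx xy.
Qed.

Lemma avoids_sub (tau x y : word) : subseq x y -> avoids tau y -> avoids tau x.
Proof. by move=> xy; apply: contra; exact: contains_sub. Qed.

Lemma avoids_short (tau x : word) : size x < size tau -> avoids tau x.
Proof.
move=> lt_x; apply/containsP => -[s /size_subseq sx /andP[/eqP ss _]].
by move: sx; rewrite ss leqNgt lt_x.
Qed.

Lemma order_iso_nth (s p : word) : order_iso s p ->
  forall u v, u < size p -> v < size p ->
  (nth 0 s u < nth 0 s v) = (nth 0 p u < nth 0 p v).
Proof.
case/andP=> _ /allP iso u v up vp.
have /iso/allP/(_ v) : u \in iota 0 (size p) by rewrite mem_iota.
by rewrite mem_iota => /(_ vp)/andP[/eqP].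
Qed.

Lemma order_iso_size (s p : word) : order_iso s p -> size s = size p.
Proof. by case/andP=> /eqP. Qed.

Lemma contains_same_size (tau x : word) :
  size x = size tau -> contains tau x -> order_iso x tau.
Proof.
move=> sz /containsP[s sx so]; have := order_iso_size so.
by rewrite -sz => /eqP; rewrite (size_subseq_leqif sx) => /eqP <-.
Qed.

Lemma order_iso_map (f : nat -> nat) (s : word) :
  {mono f : m n / m <= n} -> order_iso (map f s) s.
Proof.
move=> f_mono; rewrite /order_iso size_map eqxx /=.
apply/allP => u; rewrite mem_iota => /= us.
apply/allP => v; rewrite mem_iota => /= vs.
by rewrite !(nth_map 0) // !ltnNge !eqn_leq !f_mono !eqxx.
Qed.

(** Every intermediate stack is a suffix of the last one, so it is enough to test the last one. *)
Lemma stack_run_pushes (tau st x y : word) :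
    avoids tau (rev x ++ st) ->
  stack_run tau st (x ++ y) = stack_run tau (rev x ++ st) y.
Proof.
elim: x st => //= a x IH st; rewrite rev_cons cat_rcons => av.
have av_a : avoids tau (a :: st) by apply: avoids_sub av; exact: suffix_subseq.
rewrite -IH //; case: st {av} av_a => // b st.
by rewrite /stack_push => ->.
Qed.

(** As long as [b] is on the stack, pushing [a] would create the occurrence in [a :: b :: q]; so
    everything down to [b] is popped. *)
Lemma stack_push_pop (tau p q : word) (a b : nat) : 1 < size tau ->
    contains tau (a :: b :: q) -> avoids tau (a :: q) ->
  stack_push tau a (p ++ b :: q) = (rcons p b, a :: q).
Proof.
move=> tau_gt1 ctn av; elim: p => [|c p IH].
  rewrite /= /avoids ctn /=.
  (* An empty [q] is the case where the push is made without a test. *)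
  by case: q av {ctn} => //= d q; rewrite /avoids => ->.
rewrite cat_cons /stack_push -/stack_push IH /avoids.
have sub_cp := cat_subseq (subseq_refl [:: a]) (suffix_subseq (c :: p) (b :: q)).
by rewrite (contains_sub sub_cp ctn).
Qed.

(** The run common to all four witnesses: the letters before [a] are all pushed, then [a] pops
    exactly [p] and [b]. *)
Lemma stack_sort_pop (sigma p q y : word) (a b : nat) : 1 < size sigma ->
    avoids sigma (p ++ b :: q) -> contains sigma (a :: b :: q) ->
    avoids sigma (a :: q) ->
  stack_sort sigma (rev (y ++ a :: p ++ b :: q)) =
    p ++ b :: stack_run sigma (a :: q) (rev y).
Proof.
move=> sz av ctn av'; rewrite rev_cat rev_cons cat_rcons /stack_sort.
by rewrite stack_run_pushes revK cats0 //= stack_push_pop // cat_rcons.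
Qed.

(** * Cayley permutations, small patterns, and 132 as the unsortable pattern *)

(** In this form, being Cayley visibly depends only on the set of letters, so reversing a word or
    repeating a letter is harmless. *)
Lemma cayleyP (w : word) :
  reflect (exists m, forall x, (x \in w) = (0 < x <= m)) (cayley w).
Proof.
apply: (iffP andP) => [[w0 /allP all_w]|[m mem_w]].
  exists (\max_(i <- w) i) => x; apply/idP/idP => [xw|xm].
    rewrite lt0n; apply/andP; split; first by apply: contraNneq w0 => <-.
    by rewrite (big_rem x) //= leq_maxl.
  by apply: all_w; rewrite mem_iota add1n ltnS.
split; first by rewrite mem_w.
apply/allP => x; rewrite mem_iota add1n ltnS mem_w => /andP[-> /=] /leq_trans; apply.
by apply/bigmax_leqP_seq => i; rewrite mem_w => /andP[].
Qed.

Lemma avoids_231 (sigma : word) : cayley sigma -> 1 < size sigma ->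
    sigma <> [:: 1; 2] -> sigma <> [:: 2; 1] -> sigma <> [:: 2; 3; 1] ->
  avoids sigma [:: 2; 3; 1].
Proof.
move=> /cayleyP[m mem_s] sz n12 n21 n231; apply/containsP => -[s].
rewrite -mem_subseqs => s_sub iso.
have sz_s : size s = size sigma := order_iso_size iso.
have lt_s := order_iso_nth iso.
(* A word of length at most three without gaps is pinned down by asking which of 1, 2, 3 occur in
   it. *)
have m1 := mem_s 1; have m2 := mem_s 2; have m3 := mem_s 3.
case: sigma sz {iso} n12 n21 n231 sz_s lt_s mem_s m1 m2 m3 =>
  [|x [|y [|z [|? ?]]]] // _.
- move=> n12 n21 _ sz_s lt_s mem_s.
  have := mem_s x; have := mem_s y.
  have := lt_s 0 1 isT isT; have := lt_s 1 0 isT isT.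
  rewrite !inE !eqxx /= {lt_s mem_s}.
  have {}n12 : ~~ ((x == 1) && (y == 2)).
    by apply/andP => -[/eqP xE /eqP yE]; case: n12; rewrite xE yE.
  have {}n21 : ~~ ((x == 2) && (y == 1)).
    by apply/andP => -[/eqP xE /eqP yE]; case: n21; rewrite xE yE.
  move: s_sub; rewrite !inE => s_sub.
  by repeat case/orP: s_sub => s_sub; move/eqP: s_sub sz_s => -> //= _; lia.
- move=> _ _ n231 sz_s lt_s mem_s.
  have := mem_s x; have := mem_s y; have := mem_s z.
  have := lt_s 0 1 isT isT; have := lt_s 1 2 isT isT; have := lt_s 2 0 isT isT.
  rewrite !inE !eqxx /= {lt_s mem_s}.
  have {}n231 : ~~ [&& x == 2, y == 3 & z == 1].
    by apply/and3P => -[/eqP xE /eqP yE /eqP zE]; case: n231; rewrite xE yE zE.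
  move: s_sub; rewrite !inE => s_sub.
  by repeat case/orP: s_sub => s_sub; move/eqP: s_sub sz_s => -> //= _; lia.
move=> _ _ _ sz_s _ _ _ _ _.
by move: s_sub; rewrite mem_subseqs => /size_subseq; rewrite sz_s /= !ltnS ltn0.
Qed.

Lemma Sort_not_class_of (sigma x t : word) :
    cayley x -> sorted leq (machine sigma x) ->
    cayley t -> contains t x -> ~~ sorted leq (machine sigma t) ->
  ~ is_class (Sort sigma).
Proof.
move=> x_cayley x_sorted t_cayley tx /negP t_unsorted [_ down].
have /andP[_ //] : Sort sigma t.
by apply: (down x) => //; rewrite /Sort x_cayley.
Qed.

Lemma Sort21_not_class : ~ is_class (Sort [:: 2; 1]).
Proof.
(* Here 132 is sortable. The witness is the classical one for two passes through a stack: 3241 is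
   unsortable, but inserting 5 makes it sortable. *)
by apply: (@Sort_not_class_of _ [:: 3; 5; 2; 4; 1] [:: 3; 2; 4; 1]);
  rewrite // /cayley unlock.
Qed.

Lemma Sort231_not_class : ~ is_class (Sort [:: 2; 3; 1]).
Proof.
(* Again 132 is sortable; the unsortable pattern is 1324, occurring as 1425. *)
by apply: (@Sort_not_class_of _ [:: 3; 6; 1; 4; 2; 5] [:: 1; 3; 2; 4]);
  rewrite // /cayley unlock.
Qed.

Lemma machine132_unsorted (sigma : word) : avoids sigma [:: 2; 3; 1] ->
  ~~ sorted leq (machine sigma [:: 1; 3; 2]).
Proof.
move=> av; rewrite /machine {2}/stack_sort.
(* The 21-stack receives 231 and outputs 213. *)
by rewrite -[[:: 1; 3; 2]]cats0 stack_run_pushes.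
Qed.

Lemma contains_132 (x : word) (a b c : nat) :
  a < b < c -> subseq [:: b; c; a] x -> contains [:: 1; 3; 2] (rev x).
Proof.
move=> /andP[ab bc] sx; apply/containsP; exists [:: a; c; b].
  by rewrite -[[:: a; c; b]]/(rev [:: b; c; a]) subseq_rev.
by rewrite /order_iso /=; repeat (apply/andP; split=> //); lia.
Qed.

Lemma cayley_rev (w : word) : cayley w -> cayley (rev w).
Proof.
by case/cayleyP=> m mem_w; apply/cayleyP; exists m => x; rewrite mem_rev.
Qed.

(** The input is [rev w], so that [w] reads like a stack from top to bottom; the 132 then appears in
    [w] as [b], [c], [a]. *)
Lemma Sort_not_class (sigma w out : word) (a b c : nat) :
    avoids sigma [:: 2; 3; 1] -> cayley w -> stack_sort sigma (rev w) = out ->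
    av231 out -> a < b < c -> subseq [:: b; c; a] w ->
  ~ is_class (Sort sigma).
Proof.
move=> av w_cayley sort_w av_out abc sub_w.
apply: (@Sort_not_class_of _ (rev w) [:: 1; 3; 2]).
- exact: cayley_rev.
- by rewrite /machine sort_w av231_sort21.
- by rewrite /cayley unlock.
- exact: contains_132 sub_w.
exact: machine132_unsorted.
Qed.

(** * Tools for checking the witnesses and their outputs *)

Lemma no_hi_lo_cons_le (b c : nat) (x : word) :
  c <= b -> no_hi_lo b (c :: x) = no_hi_lo b x.
Proof.
by move=> cb; rewrite /no_hi_lo /= (eq_all (a2 := predT)) ?all_predT // => a /=; lia.
Qed.

Lemma no_hi_lo_min (b : nat) (x : word) : all (leq b) x -> no_hi_lo b x.
Proof.
move=> /allP ge_b; apply/(pairwiseP 0) => i j _ jx _.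
by rewrite negb_and -leqNgt (ge_b _ (mem_nth 0 jx)).
Qed.

Lemma no_hi_lo_max (b : nat) (x : word) : all (geq b) x -> no_hi_lo b x.
Proof.
move=> /allP le_b; apply/(pairwiseP 0) => i j ix _ _.
by rewrite negb_and -!leqNgt [X in _ || X](le_b _ (mem_nth 0 ix)) orbT.
Qed.

Lemma no_hi_lo_mapS (b : nat) (x : word) :
  no_hi_lo b.+1 (map S x) = no_hi_lo b x.
Proof. by rewrite /no_hi_lo pairwise_map. Qed.

Lemma av231_mapS (x : word) : av231 (map S x) = av231 x.
Proof. by elim: x => //= b x ->; rewrite no_hi_lo_mapS. Qed.

Lemma cayley_mapS (sigma w : word) : cayley sigma ->
  w =i 1 :: map S sigma -> cayley w.
Proof.
case/cayleyP=> m mem_s mem_w; apply/cayleyP; exists m.+1 => -[|x].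
  by rewrite mem_w; apply/mapP => -[].
by rewrite mem_w inE (mem_map succn_inj) mem_s; lia.
Qed.

Lemma cayley_cons_max (w : word) : cayley w ->
  exists m, all (geq m) w /\ forall w', w' =i m.+1 :: w -> cayley w'.
Proof.
case/cayleyP=> m mem_w; exists m; split.
  by apply/allP => x; rewrite mem_w => /andP[].
move=> w' mem_w'; apply/cayleyP; exists m.+1 => x.
by rewrite mem_w' inE mem_w; lia.
Qed.

Lemma contains_mapS (sigma : word) : contains sigma (map S sigma).
Proof. by apply/containsP; exists (map S sigma); rewrite ?order_iso_map. Qed.

(** In an occurrence starting at [c], the second letter would compare with [c] as in [sigma], which
    no letter of [x] does. *)
Lemma avoids_cons (sigma x : word) (c : nat) : 1 < size sigma ->
    avoids sigma x ->
    all (fun d => (d < c) != (nth 0 sigma 1 < nth 0 sigma 0)) x ->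
  avoids sigma (c :: x).
Proof.
move=> sz av /allP neq; apply/containsP => -[s s_sub iso].
have sz_s : size s = size sigma := order_iso_size iso.
have lt_s := order_iso_nth iso (u := 1) (v := 0) sz (ltnW sz).
case: s s_sub iso sz_s lt_s => [|d [|e s]] /=; [by move=> *; lia..|].
case: eqP => [-> s_sub iso _ lt_s|_ s_sub iso _ _].
  by have /eqP := neq e (mem_subseq s_sub (mem_head _ _)).
by move/containsP: av; apply; exists [:: d, e & s].
Qed.

Lemma subseq_third_mem (c c' d e f : nat) (s x : word) :
  subseq [:: d, e, f & s] [:: c, c' & x] -> f \in x.
Proof.
rewrite [subseq _ _]/=; case: (d == c); case: ifP => _ /mem_subseq;
  by apply; rewrite !inE eqxx ?orbT.
Qed.

(** * The four cases, according to the order of the first two letters *)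

Section Cases.
Variables (a b : nat) (t : word).
Hypothesis sigma_cayley : cayley [:: a, b & t].
Hypothesis av_sigma : avoids [:: a, b & t] [:: 2; 3; 1].
Hypothesis av_hat : av231 [:: b, a & t].

(** The word is as long as the pattern, so an occurrence would be all of it; but it starts with a
    descent and the pattern does not. *)
Let av_desc (x y : nat) : y < x -> a <= b ->
  avoids [:: a, b & t] [:: x, y & map S t].
Proof.
move=> yx ab; apply/negP => /contains_same_size.
rewrite /= size_map => /(_ erefl)/order_iso_nth/(_ 1 0 isT isT) /=; lia.
Qed.

Let all_tS : all (leq 1) (map S t).
Proof. by apply/allP => _ /mapP[x _ ->]. Qed.

Let a_gt0 : 0 < a.
Proof.
have [m mem_s] := cayleyP _ sigma_cayley.
by have := mem_s a; rewrite mem_head; lia.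
Qed.

Let b_gt0 : 0 < b.
Proof.
have [m mem_s] := cayleyP _ sigma_cayley.
by have := mem_s b; rewrite !inE eqxx orbT; lia.
Qed.

Let contains_ins (q : word) : subseq (map S t) q ->
  contains [:: a, b & t] [:: a.+1, b.+1 & q].
Proof. by move=> tq; apply: contains_sub (contains_mapS _); rewrite /= !eqxx. Qed.

(** The added 1 is a minimum and cannot be the 3 of a 231, so only the shifted [b], [a], [t]
    matters. *)
Let av_out : a <= b -> av231 [:: b.+1, a.+1, 1 & map S t].
Proof.
move=> ab; have /= := av_hat; rewrite no_hi_lo_cons_le // => /and3P[bt at_ av_t].
rewrite /= !no_hi_lo_cons_le // !no_hi_lo_mapS bt at_ av231_mapS av_t.
by rewrite no_hi_lo_min //; apply/allP.
Qed.

(** The inserted 1 is the 1 of the 132, and it also puts a descent on top of the stack, which delays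
    the occurrence until [a.+1] meets [b.+1]. *)
Lemma Sort_not_class_lt : a < b -> ~ is_class (Sort [:: a, b & t]).
Proof.
move=> ab; have ab' := ltnW ab.
apply: (@Sort_not_class _ [:: a.+1, b.+1, 1 & map S t] _ 1 a.+1 b.+1
  av_sigma _ _ (av_out ab')) => //=.
- apply: cayley_mapS sigma_cayley _ => x; rewrite !inE.
  by do 2!case: (_ == _); rewrite ?orbT.
- apply: (@stack_sort_pop _ [::] (1 :: map S t) [::]) => //.
  + by apply: av_desc; lia.
  + by apply: contains_ins; exact: subseq_cons.
  by apply: av_desc; lia.
- by rewrite !ltnS a_gt0.
by rewrite !eqxx sub0seq.
Qed.

(** Since [b] is no longer larger than [a], a new maximum [c.+1] serves as the 3; lying above
    [b.+1], it is popped with it. *)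
Lemma Sort_not_class_eq : a = b -> ~ is_class (Sort [:: a, b & t]).
Proof.
move=> ab; have ab' : a <= b by rewrite ab.
have /cayley_cons_max[c [/= /and4P[c1 ca cb ct] cayley_c]] :=
  cayley_mapS sigma_cayley (fun=> erefl).
apply: (@Sort_not_class _ [:: a.+1, c.+1, b.+1, 1 & map S t]
  [:: c.+1, b.+1, a.+1, 1 & map S t] 1 a.+1 c.+1) => //.
- apply: cayley_c => x; rewrite !inE.
  by do 4!case: (_ == _); rewrite ?orbT.
- apply: (@stack_sort_pop _ [:: c.+1] (1 :: map S t) [::]) => //.
  (* All letters under [c.+1] are smaller than it, whereas the pattern starts with two equal
     letters. *)
  + apply: avoids_cons => //; first by apply: av_desc; lia.
    rewrite /= ab ltnn !eqbF_neg !negbK !ltnS cb c1 /=.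
    by apply: sub_all ct => x /= xc; rewrite ltnS xc.
  + by apply: contains_ins; exact: subseq_cons.
  by apply: av_desc; lia.
- apply/andP; split; last exact: av_out.
  apply: no_hi_lo_max; rewrite /= !leqW //.
  by apply: sub_all ct => x /=; exact: leqW.
- by rewrite !ltnS a_gt0 (leq_trans _ ca).
by rewrite /= !eqxx; case: (1 == b.+1); rewrite /= ?sub0seq.
Qed.

(** Here [b] is the 1 of the 132 and [c.+1] the 3. The new maximum cannot replace [a] in front of
    [b] and [t], because some letter of [t] is at least [a]. *)
Lemma Sort_not_class_gt : b < a -> ~~ all (gtn a) t ->
  ~ is_class (Sort [:: a, b & t]).
Proof.
move=> ba /allPn[x xt]; rewrite /= -leqNgt => ax.
have /cayley_cons_max[c [/= /and3P[ca cb ct] cayley_c]] := sigma_cayley.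
apply: (@Sort_not_class _ [:: a, c.+1, b & t] [:: c.+1, b, a & t] b a c.+1) => //.
- apply: cayley_c => y; rewrite !inE.
  by do 2!case: (_ == _); rewrite ?orbT.
- apply: (@stack_sort_pop _ [:: c.+1] t [::]) => //=.
  + apply/negP => /contains_same_size-/(_ erefl)/order_iso_nth.
    have it : index x t < size t by rewrite index_mem.
    move/(_ (index x t).+2 0 it isT); rewrite /= nth_index // ltnS.
    by rewrite (allP ct _ xt : x <= c) ltnNge ax.
  + apply/containsP; exists [:: a, b & t] => //.
    by rewrite -{1}(map_id [:: a, b & t]) order_iso_map.
  exact: avoids_short.
- apply/andP; split=> //.
  apply: no_hi_lo_max; rewrite /= !leqW //.
  by apply: sub_all ct => y /=; exact: leqW.
- by rewrite ba ltnS.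
by rewrite /= !eqxx ?sub0seq.
Qed.

(** A new maximum on top of [b] and [t] would already complete the pattern, so [a.+2] serves as the
    3. Its arrival pops the 1 of the 132 with both copies of [b.+2], before the 2 is read. *)
Lemma Sort_not_class_gt_max : b < a -> t != [::] -> all (gtn a) t ->
  ~ is_class (Sort [:: a, b & t]).
Proof.
move=> ba t_neq0 ta; pose SS := map (fun x => x.+2).
have SSE x : SS x = map S (map S x) by rewrite /SS -map_comp.
have /andP[/andP[bt _] _] := av_hat.
have {}bt : all (leq b) t by apply: sub_all bt => x /=; rewrite ba andbT -leqNgt.
have bSS : all (leq b.+2) (SS t) by rewrite all_map.
have SS2 : all (leq 2) (SS t) by rewrite all_map; apply: sub_all bt.
apply: (@Sort_not_class _ [:: 2, a.+2, b.+2, 1, b.+2 & SS t]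
  [:: b.+2, 1, b.+2, 2, a.+2 & SS t] 1 2 a.+2) => //.
(* Two successive shifts free the values 1 and 2, used for the letters 0 and 1/2. *)
- apply: (@cayley_mapS (1 :: map S [:: a, b & t])).
    exact: cayley_mapS sigma_cayley (fun=> erefl).
  move=> x; rewrite SSE !inE /=.
  by do 4!case: (_ == _); rewrite ?orbT.
- have run2 : stack_run [:: a, b & t] (a.+2 :: SS t) (rev [:: 2]) =
      [:: 2, a.+2 & SS t].
    apply: (@stack_run_pushes _ _ [:: 2] [::]).
    apply/negP => /contains_same_size.
    by rewrite /= size_map => /(_ erefl)/order_iso_nth/(_ 1 0 isT isT) /=; lia.
  rewrite -run2.
  apply: (@stack_sort_pop _ [:: b.+2; 1] (SS t) [:: 2] a.+2 b.+2) => //.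
  + have av1 : avoids [:: a, b & t] [:: 1, b.+2 & SS t].
      apply: avoids_cons => //; first by apply: avoids_short; rewrite /= size_map.
      by rewrite /= ba all_map; apply/allP.
    have t_gt0 : 0 < size t by rewrite lt0n size_eq0.
    have t0a : nth 0 t 0 < a := allP ta _ (mem_nth 0 t_gt0).
    have bSSt : all (leq b.+2) (b.+2 :: SS t) by rewrite /= leqnn.
    (* If an occurrence starts at the topmost [b.+2], its third letter is at least [b.+2], but the
       third letter of the pattern is below [a]. Otherwise it lies in the word of [av1]. *)
    apply/containsP => -[s s_sub iso]; move/containsP: av1; apply.
    exists s => //; have := order_iso_nth iso (u := 2) (v := 0) _ isT.
    have {iso} sz_s : 2 < size s by rewrite (order_iso_size iso).
    case: s sz_s s_sub => [|d [|e [|f s]]] // _ s_sub /(_ t_gt0) /=.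
    have /(allP bSSt) /= bf := subseq_third_mem s_sub.
    case: (d =P b.+2) s_sub => [->|/eqP db]; first by rewrite t0a ltnNge bf.
    by rewrite [subseq _ _]/= (negPf db) => s_sub _; exact: s_sub.
  + apply/containsP; exists (map (fun x => x.+2) [:: a, b & t]) => //.
    exact: order_iso_map.
  by apply: avoids_short; rewrite /= size_map.
- have /and3P[nhl_b nhl_a av_SS] : av231 (SS [:: b, a & t]).
    by rewrite SSE !av231_mapS.
  have all2 : all (leq 2) [:: a.+2 & SS t] by [].
  have all1 : all (leq 1) [:: b.+2, 2, a.+2 & SS t].
    by apply: sub_all all2 => x; exact: ltnW.
  (* The letters 1 and 2 are minima of what follows them, and for a 2 equal to [b.+2] none of 1, 2,
     [b.+2] can be the 3. *)
  apply/and5P; split; [|exact: no_hi_lo_min| |exact: no_hi_lo_min|exact/andP].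
    by rewrite 3?no_hi_lo_cons_le.
  by rewrite no_hi_lo_cons_le.
by rewrite /= !eqxx ?sub0seq.
Qed.
End Cases.

Theorem theorem4 (sigma : word) (sigma_cayley : cayley sigma)
    (size_sigma : 2 <= size sigma) (sigma_neq12 : sigma <> [:: 1; 2])
    (hat_avoids : avoids [:: 2; 3; 1] (hat sigma)) :
  ~ is_class (Sort sigma).
Proof.
have [->|/eqP n21] := eqVneq sigma [:: 2; 1]; first exact: Sort21_not_class.
have [->|/eqP n231] := eqVneq sigma [:: 2; 3; 1]; first exact: Sort231_not_class.
have av_sigma := avoids_231 sigma_cayley size_sigma sigma_neq12 n21 n231.
have {hat_avoids} := avoids_av231 hat_avoids.
case: sigma sigma_cayley size_sigma n21 av_sigma {n231 sigma_neq12} => [|a [|b t]] //.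
move=> sigma_cayley _ n21 av_sigma av_hat.
have [ab|ba|ab] := ltngtP a b.
- exact: Sort_not_class_lt.
- have [ta|] := boolP (all (gtn a) t); last exact: Sort_not_class_gt.
  (* An empty [t] would leave only the pattern 21, treated separately. *)
  apply: Sort_not_class_gt_max => //; apply/eqP => t0; case: n21.
  have /cayleyP[m mem_s] := sigma_cayley; have := mem_s 1; have := mem_s 2.
  have := mem_s a; have := mem_s b.
  rewrite t0 !inE !eqxx orbT => mb ma m2 m1.
  by have [-> ->] : a = 2 /\ b = 1 by lia.
exact: Sort_not_class_eq.
Qed.
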